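(* Let $\mathcal C$ be a (strict) braided monoidal category in which idempotents split, and let $A=(A,\mathrm m_A,\eta_A,\Delta_A,\varepsilon_A)$ be a bialgebra in $\mathcal C$. Then the following statements are equivalent. (1) $A$ is bialgebra isomorphic to a cross product bialgebra. (2) There are idempotents $\Pi_1,\Pi_2\in\mathrm{End}(A)$ such that for $j\in\{1,2\}$ $$\mathrm m_A\circ(\Pi_j\otimes\Pi_j)=\Pi_j\circ\mathrm m_A\circ(\Pi_j\otimes\Pi_j),\quad\Pi_j\circ\eta_A=\eta_A,$$ $$(\Pi_j\otimes\Pi_j)\circ\Delta_A=(\Pi_j\otimes\Pi_j)\circ\Delta_A\circ\Pi_j,\quad\varepsilon_A\circ\Pi_j=\varepsilon_A,$$ and the sequence $A\otimes A\xrightarrow{\mathrm m_A\circ(\Pi_1\otimes\Pi_2)}A\xrightarrow{(\Pi_1\otimes\Pi_2)\circ\Delta_A}A\otimes A$ is a splitting of the idempotent $\Pi_1\otimes\Pi_2$ of $A\otimes A$. (3) There exist objects $B_1$ and $B_2$ in $\mathcal C$ which are at the same time algebras and coalgebras, algebra morphisms $\mathrm i_j:B_j\to A$ and coalgebra morphisms $\mathrm p_j:A\to B_j$ such that $\mathrm p_j\circ\mathrm i_j=\mathrm{id}_{B_j}$ for $j\in\{1,2\}$, and the morphisms $\mathrm m_A\circ(\mathrm i_1\otimes\mathrm i_2):B_1\otimes B_2\to A$ and $(\mathrm p_1\otimes\mathrm p_2)\circ\Delta_A:A\to B_1\otimes B_2$ are inverse to each other.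
   Context: $\mathcal C$ has tensor product $\otimes$, unit object $I$, braiding $\Psi$. Algebras are unital associative, coalgebras counital coassociative, bialgebras are in the braided sense: $\Delta\circ\mathrm m=(\mathrm m\otimes\mathrm m)\circ(\mathrm{id}\otimes\Psi\otimes\mathrm{id})\circ(\Delta\otimes\Delta)$, with $\varepsilon$ an algebra morphism and $\eta$ a coalgebra morphism. Splitting: a sequence $M\xrightarrow{p}N\xrightarrow{i}M$ splits an idempotent $\Pi:M\to M$ if $p\circ i=\mathrm{id}_N$ and $i\circ p=\Pi$. Cross product bialgebra: a bialgebra admissible tuple (BAT) consists of objects $B_j$ ($j=1,2$), each with an algebra structure $(\mathrm m_j,\eta_j)$ and a coalgebra structure $(\Delta_j,\varepsilon_j)$ with $\varepsilon_j\circ\eta_j=\mathrm{id}_I$, and morphisms $\varphi_{1,2}:B_1\otimes B_2\to B_2\otimes B_1$, $\varphi_{2,1}:B_2\otimes B_1\to B_1\otimes B_2$, such that $B_1\otimes B_2$ is a bialgebra with $\mathrm m_\times=(\mathrm m_1\otimes\mathrm m_2)\circ(\mathrm{id}_{B_1}\otimes\varphi_{2,1}\otimes\mathrm{id}_{B_2})$, $\eta_\times=\eta_1\otimes\eta_2$, $\Delta_\times=(\mathrm{id}_{B_1}\otimes\varphi_{1,2}\otimes\mathrm{id}_{B_2})\circ(\Delta_1\otimes\Delta_2)$, $\varepsilon_\times=\varepsilon_1\otimes\varepsilon_2$. This bialgebra is called the cross product bialgebra associated to the BAT. *)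

(* Defs.v *)
From Corelib Require Import ssreflect.

Set Implicit Arguments.
Unset Strict Implicit.
Unset Printing Implicit Defensive.

(* Braided monoidal categories carry explicit associativity and unit
   constraints.  A strict one is the case where the constraints are the
   identities; imposing this in type theory would mean transporting along
   equalities of objects. *)

Declare Scope obj_scope.
Delimit Scope obj_scope with obj.
Declare Scope hom_scope.
Delimit Scope hom_scope with hom.

Reserved Notation "X ~> Y" (at level 90, right associativity).
Reserved Notation "g ∘ f" (at level 50, left associativity).
Reserved Notation "x ⊗ y" (at level 40, left associativity).

Record category := Category {
  obj :> Type;
  hom : obj -> obj -> Type;
  idm : forall X : obj, hom X X;
  comp : forall X Y Z : obj, hom Y Z -> hom X Y -> hom X Z;
  compA : forall (X Y Z W : obj) (h : hom Z W) (g : hom Y Z) (f : hom X Y),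
    comp h (comp g f) = comp (comp h g) f;
  comp1m : forall (X Y : obj) (f : hom X Y), comp (idm Y) f = f;
  compm1 : forall (X Y : obj) (f : hom X Y), comp f (idm X) = f
}.

Bind Scope obj_scope with obj.
Bind Scope hom_scope with hom.
Arguments hom {c} X%_obj Y%_obj.
Arguments idm {c} X%_obj.
Arguments comp {c} {X Y Z}%_obj (g f)%_hom.

Notation "X ~> Y" := (hom X Y) : type_scope.
Notation "g ∘ f" := (comp g f) : hom_scope.
Open Scope hom_scope.

Definition inverse_morphisms (C : category) (X Y : C) (f : X ~> Y)
    (g : Y ~> X) : Prop :=
  g ∘ f = idm X /\ f ∘ g = idm Y.

Record monoidal_category := MonoidalCategory {
  mon_cat :> category;
  tens : mon_cat -> mon_cat -> mon_cat;
  tensm : forall X Y X' Y' : mon_cat,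
    X ~> X' -> Y ~> Y' -> tens X Y ~> tens X' Y';
  tunit : mon_cat;
  tensm_id : forall X Y : mon_cat, tensm (idm X) (idm Y) = idm (tens X Y);
  tensm_comp : forall (X Y X' Y' X'' Y'' : mon_cat)
      (f : X ~> X') (f' : X' ~> X'') (g : Y ~> Y') (g' : Y' ~> Y''),
    tensm (f' ∘ f) (g' ∘ g) = tensm f' g' ∘ tensm f g;
  assoc : forall X Y Z : mon_cat, tens (tens X Y) Z ~> tens X (tens Y Z);
  associ : forall X Y Z : mon_cat, tens X (tens Y Z) ~> tens (tens X Y) Z;
  assocK : forall X Y Z : mon_cat,
    inverse_morphisms (assoc X Y Z) (associ X Y Z);
  assoc_nat : forall (X Y Z X' Y' Z' : mon_cat)
      (f : X ~> X') (g : Y ~> Y') (h : Z ~> Z'),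
    assoc X' Y' Z' ∘ tensm (tensm f g) h
    = tensm f (tensm g h) ∘ assoc X Y Z;
  lunit : forall X : mon_cat, tens tunit X ~> X;
  luniti : forall X : mon_cat, X ~> tens tunit X;
  lunitK : forall X : mon_cat, inverse_morphisms (lunit X) (luniti X);
  lunit_nat : forall (X Y : mon_cat) (f : X ~> Y),
    lunit Y ∘ tensm (idm tunit) f = f ∘ lunit X;
  runit : forall X : mon_cat, tens X tunit ~> X;
  runiti : forall X : mon_cat, X ~> tens X tunit;
  runitK : forall X : mon_cat, inverse_morphisms (runit X) (runiti X);
  runit_nat : forall (X Y : mon_cat) (f : X ~> Y),
    runit Y ∘ tensm f (idm tunit) = f ∘ runit X;
  pentagon : forall X Y Z W : mon_cat,
    assoc X Y (tens Z W) ∘ assoc (tens X Y) Z W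
    = tensm (idm X) (assoc Y Z W) ∘ assoc X (tens Y Z) W
      ∘ tensm (assoc X Y Z) (idm W);
  triangle : forall X Y : mon_cat,
    tensm (idm X) (lunit Y) ∘ assoc X tunit Y = tensm (runit X) (idm Y)
}.

Arguments tens {m} (X Y)%_obj.
Arguments tensm {m} {X Y X' Y'}%_obj (f g)%_hom.
Arguments tunit {m}.
Arguments assoc {m} (X Y Z)%_obj.
Arguments associ {m} (X Y Z)%_obj.
Arguments lunit {m} X%_obj.
Arguments luniti {m} X%_obj.
Arguments runit {m} X%_obj.
Arguments runiti {m} X%_obj.

Notation "X ⊗ Y" := (tens X Y) : obj_scope.
Notation "f ⊗ g" := (tensm f g) : hom_scope.

Record braided_category := BraidedCategory {
  braid_mon :> monoidal_category;
  braid : forall X Y : braid_mon, X ⊗ Y ~> Y ⊗ X;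
  braidi : forall X Y : braid_mon, Y ⊗ X ~> X ⊗ Y;
  braidK : forall X Y : braid_mon,
    inverse_morphisms (braid X Y) (braidi X Y);
  braid_nat : forall (X Y X' Y' : braid_mon) (f : X ~> X') (g : Y ~> Y'),
    braid X' Y' ∘ (f ⊗ g) = (g ⊗ f) ∘ braid X Y;
  hexagon1 : forall X Y Z : braid_mon,
    assoc Y Z X ∘ braid X (Y ⊗ Z) ∘ assoc X Y Z
    = (idm Y ⊗ braid X Z) ∘ assoc Y X Z ∘ (braid X Y ⊗ idm Z);
  hexagon2 : forall X Y Z : braid_mon,
    associ Z X Y ∘ braid (X ⊗ Y) Z ∘ associ X Y Z
    = (braid X Z ⊗ idm Y) ∘ associ X Z Y ∘ (idm X ⊗ braid Y Z)
}.

Arguments braid {b} (X Y)%_obj.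
Arguments braidi {b} (X Y)%_obj.

Definition idempotent_morphism (C : category) (M : C) (P : M ~> M) : Prop :=
  P ∘ P = P.

Definition splitting (C : category) (M N : C) (P : M ~> M)
    (p : M ~> N) (i : N ~> M) : Prop :=
  p ∘ i = idm N /\ i ∘ p = P.

Definition idempotents_split (C : category) : Prop :=
  forall (M : C) (P : M ~> M), idempotent_morphism P ->
    exists (N : C) (p : M ~> N) (i : N ~> M), splitting P p i.

(* id ⊗ f ⊗ id on the two middle factors *)
Definition mid (C : monoidal_category) (X Y Z Y' Z' W : C)
    (f : Y ⊗ Z ~> Y' ⊗ Z') : (X ⊗ Y) ⊗ (Z ⊗ W) ~> (X ⊗ Y') ⊗ (Z' ⊗ W) :=
  associ X Y' (Z' ⊗ W)
  ∘ (idm X ⊗ (assoc Y' Z' W ∘ (f ⊗ idm W) ∘ associ Y Z W))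
  ∘ assoc X Y (Z ⊗ W).

Arguments mid {C} X%_obj {Y Z Y' Z'}%_obj W%_obj f%_hom.

Record algebra (C : monoidal_category) (A : C) := Algebra {
  mul : A ⊗ A ~> A;
  unit : tunit ~> A;
  mulA : mul ∘ (mul ⊗ idm A) = mul ∘ (idm A ⊗ mul) ∘ assoc A A A;
  mul1m : mul ∘ (unit ⊗ idm A) = lunit A;
  mulm1 : mul ∘ (idm A ⊗ unit) = runit A
}.

Record coalgebra (C : monoidal_category) (A : C) := Coalgebra {
  comul : A ~> A ⊗ A;
  counit : A ~> tunit;
  comulA : assoc A A A ∘ (comul ⊗ idm A) ∘ comul = (idm A ⊗ comul) ∘ comul;
  comul1m : (counit ⊗ idm A) ∘ comul = luniti A;
  comulm1 : (idm A ⊗ counit) ∘ comul = runiti A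
}.

Definition algebra_morphism (C : monoidal_category) (A B : C)
    (a : algebra A) (b : algebra B) (f : A ~> B) : Prop :=
  f ∘ mul a = mul b ∘ (f ⊗ f) /\ f ∘ unit a = unit b.

Definition coalgebra_morphism (C : monoidal_category) (A B : C)
    (a : coalgebra A) (b : coalgebra B) (f : A ~> B) : Prop :=
  comul b ∘ f = (f ⊗ f) ∘ comul a /\ counit b ∘ f = counit a.

(* I is an algebra through lunit : I ⊗ I ~> I and a coalgebra through
   luniti; [bialg_counit_*] and [bialg_unit_*] say that the counit is an
   algebra morphism and the unit a coalgebra morphism.  The condition
   counit ∘ unit = id is common to both. *)
Record bialgebra (C : braided_category) (A : C) := Bialgebra {
  bialg_alg :> algebra A;
  bialg_coalg :> coalgebra A;
  bialg_comul_mul : comul bialg_coalg ∘ mul bialg_alg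
    = (mul bialg_alg ⊗ mul bialg_alg) ∘ mid A A (braid A A)
      ∘ (comul bialg_coalg ⊗ comul bialg_coalg);
  bialg_counit_mul : counit bialg_coalg ∘ mul bialg_alg
    = lunit tunit ∘ (counit bialg_coalg ⊗ counit bialg_coalg);
  bialg_unit_comul : comul bialg_coalg ∘ unit bialg_alg
    = (unit bialg_alg ⊗ unit bialg_alg) ∘ luniti tunit;
  bialg_counit_unit : counit bialg_coalg ∘ unit bialg_alg = idm tunit
}.

Definition bialgebra_morphism (C : braided_category) (A B : C)
    (a : bialgebra A) (b : bialgebra B) (f : A ~> B) : Prop :=
  algebra_morphism a b f /\ coalgebra_morphism a b f.

Definition bialgebra_isomorphic (C : braided_category) (A B : C)
    (a : bialgebra A) (b : bialgebra B) : Prop :=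
  exists (f : A ~> B) (g : B ~> A),
    bialgebra_morphism a b f /\ bialgebra_morphism b a g
    /\ inverse_morphisms f g.

(* Bialgebra admissible tuples.  [bat_bialg] is the associated cross product
   bialgebra: all of its operations are prescribed by the last four fields. *)
Record BAT (C : braided_category) := MkBAT {
  bat1 : C;
  bat2 : C;
  bat_alg1 : algebra bat1;
  bat_alg2 : algebra bat2;
  bat_coalg1 : coalgebra bat1;
  bat_coalg2 : coalgebra bat2;
  bat_counit_unit1 : counit bat_coalg1 ∘ unit bat_alg1 = idm tunit;
  bat_counit_unit2 : counit bat_coalg2 ∘ unit bat_alg2 = idm tunit;
  bat_phi12 : bat1 ⊗ bat2 ~> bat2 ⊗ bat1;
  bat_phi21 : bat2 ⊗ bat1 ~> bat1 ⊗ bat2;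
  bat_bialg : bialgebra (bat1 ⊗ bat2);
  bat_mul : mul bat_bialg
    = (mul bat_alg1 ⊗ mul bat_alg2) ∘ mid bat1 bat2 bat_phi21;
  bat_unit : unit bat_bialg
    = (unit bat_alg1 ⊗ unit bat_alg2) ∘ luniti tunit;
  bat_comul : comul bat_bialg
    = mid bat1 bat2 bat_phi12 ∘ (comul bat_coalg1 ⊗ comul bat_coalg2);
  bat_counit : counit bat_bialg
    = lunit tunit ∘ (counit bat_coalg1 ⊗ counit bat_coalg2)
}.

Definition admissible_idempotent (C : braided_category) (A : C)
    (a : bialgebra A) (P : A ~> A) : Prop :=
  idempotent_morphism P
  /\ mul a ∘ (P ⊗ P) = P ∘ mul a ∘ (P ⊗ P)
  /\ P ∘ unit a = unit a
  /\ (P ⊗ P) ∘ comul a = (P ⊗ P) ∘ comul a ∘ P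
  /\ counit a ∘ P = counit a.

(* Main.v *)
(** The idempotents are [P_j = i_j ∘ p_j]; conversely a splitting of [P_j]
    inherits an algebra structure along [i_j] and a coalgebra structure along
    [p_j].  In a cross product, unitality of [m_×] forces
    [φ21 ∘ (η2 ⊗ id) = id ⊗ η2] and [φ21 ∘ (id ⊗ η1) = η1 ⊗ id], which makes
    [i1 = id ⊗ η2] and [i2 = η1 ⊗ id] algebra morphisms with
    [m_× ∘ (i1 ⊗ i2) = id].  Conversely, with [F = m_A ∘ (i1 ⊗ i2)] and
    [G = (p1 ⊗ p2) ∘ Δ_A] mutually inverse, [φ21 = G ∘ m_A ∘ (i2 ⊗ i1)] and
    [φ12 = (p2 ⊗ p1) ∘ Δ_A ∘ F] describe the bialgebra structure transported
    to [B1 ⊗ B2].  Every coalgebra statement is the algebra statement in the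
    opposite monoidal category. *)

From Corelib Require Import ssreflect ssrfun.
Require Import Defs.

Set Implicit Arguments.
Unset Strict Implicit.
Unset Printing Implicit Defensive.

(** * Cancellation in a category *)

Section Categories.
Variable C : category.

Lemma comp_tail (X Y Z W : C) (g : Y ~> Z) (f : X ~> Y) (k : X ~> Z)
    (h : W ~> X) : g ∘ f = k -> g ∘ (f ∘ h) = k ∘ h.
Proof. by move=> <-; rewrite compA. Qed.

Lemma comp_cancel (X Y W : C) (g : Y ~> X) (f : X ~> Y) (h : W ~> X) :
  g ∘ f = idm X -> g ∘ (f ∘ h) = h.
Proof. by move=> e; rewrite (comp_tail _ e) comp1m. Qed.

Lemma inverse_monic (X Y W : C) (f : X ~> Y) (g : Y ~> X) (h k : W ~> X) :
  inverse_morphisms f g -> f ∘ h = f ∘ k -> h = k.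
Proof.
by case=> gf _ e; rewrite -[h](comp_cancel _ gf) e (comp_cancel _ gf).
Qed.

Lemma inverse_epic (X Y W : C) (f : X ~> Y) (g : Y ~> X) (h k : Y ~> W) :
  inverse_morphisms f g -> h ∘ f = k ∘ f -> h = k.
Proof.
by case=> _ fg e; rewrite -[h]compm1 -[k]compm1 -fg !compA e.
Qed.

End Categories.

(** * Coherence of unit and associativity constraints *)

Section Coherence.
Variable C : monoidal_category.
Implicit Types X Y Z W : C.

Lemma tensm_compl X X' X'' Y (f : X ~> X') (f' : X' ~> X'') :
  (f' ∘ f) ⊗ idm Y = (f' ⊗ idm Y) ∘ (f ⊗ idm Y).
Proof. by rewrite -tensm_comp comp1m. Qed.

Lemma tensm_compr X Y Y' Y'' (g : Y ~> Y') (g' : Y' ~> Y'') :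
  idm X ⊗ (g' ∘ g) = (idm X ⊗ g') ∘ (idm X ⊗ g).
Proof. by rewrite -tensm_comp comp1m. Qed.

Lemma tensm_lr X Y X' Y' (f : X ~> X') (g : Y ~> Y') :
  (f ⊗ idm Y') ∘ (idm X ⊗ g) = f ⊗ g.
Proof. by rewrite -tensm_comp comp1m compm1. Qed.

Lemma tensm_rl X Y X' Y' (f : X ~> X') (g : Y ~> Y') :
  (idm X' ⊗ g) ∘ (f ⊗ idm Y) = f ⊗ g.
Proof. by rewrite -tensm_comp comp1m compm1. Qed.

Lemma tensm_inverse X Y X' Y' (f : X ~> X') (f' : X' ~> X)
    (g : Y ~> Y') (g' : Y' ~> Y) :
  inverse_morphisms f f' -> inverse_morphisms g g' ->
  inverse_morphisms (f ⊗ g) (f' ⊗ g').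
Proof.
by case=> e1 e2 [e3 e4]; split; rewrite -tensm_comp ?e1 ?e2 ?e3 ?e4 tensm_id.
Qed.

Lemma associ_nat X Y Z X' Y' Z' (f : X ~> X') (g : Y ~> Y') (h : Z ~> Z') :
  associ X' Y' Z' ∘ (f ⊗ (g ⊗ h)) = ((f ⊗ g) ⊗ h) ∘ associ X Y Z.
Proof.
apply: (inverse_monic (assocK X' Y' Z')).
rewrite (comp_cancel _ (proj2 (assocK _ _ _))) (comp_tail _ (assoc_nat _ _ _)).
by rewrite -compA (proj2 (assocK _ _ _)) compm1.
Qed.

Lemma luniti_nat X Y (f : X ~> Y) :
  (idm tunit ⊗ f) ∘ luniti X = luniti Y ∘ f.
Proof.
apply: (inverse_monic (lunitK Y)).
rewrite (comp_cancel _ (proj2 (lunitK _))) (comp_tail _ (lunit_nat _)).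
by rewrite -compA (proj2 (lunitK _)) compm1.
Qed.

Lemma runiti_nat X Y (f : X ~> Y) :
  (f ⊗ idm tunit) ∘ runiti X = runiti Y ∘ f.
Proof.
apply: (inverse_monic (runitK Y)).
rewrite (comp_cancel _ (proj2 (runitK _))) (comp_tail _ (runit_nat _)).
by rewrite -compA (proj2 (runitK _)) compm1.
Qed.

Lemma tensm_unitl_inj X Y (f g : X ~> Y) :
  idm tunit ⊗ f = idm tunit ⊗ g -> f = g.
Proof.
by move=> e; apply: (inverse_epic (lunitK X)); rewrite -!lunit_nat e.
Qed.

Lemma tensm_unitr_inj X Y (f g : X ~> Y) :
  f ⊗ idm tunit = g ⊗ idm tunit -> f = g.
Proof.
by move=> e; apply: (inverse_epic (runitK X)); rewrite -!runit_nat e.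
Qed.

Lemma idm_inverse X : inverse_morphisms (idm X) (idm X).
Proof. by split; rewrite comp1m. Qed.

(** Kelly's argument: tensoring with the unit object is faithful, and after precomposition with
    invertible associators the pentagon at [tunit], [tunit], [X], [Y] and the triangle identify both
    sides. *)
Lemma lunit_tens X Y : lunit (X ⊗ Y) ∘ assoc tunit X Y = lunit X ⊗ idm Y.
Proof.
apply: tensm_unitl_inj.
apply: (inverse_epic (assocK _ _ _)).
apply: (inverse_epic (tensm_inverse (assocK tunit tunit X) (idm_inverse Y))).
rewrite tensm_compr -!compA.
rewrite (compA (idm tunit ⊗ assoc _ _ _)) -pentagon.
rewrite (comp_tail _ (triangle _ _)) -tensm_id -assoc_nat.
rewrite (comp_tail _ (esym (assoc_nat _ _ _))) -compA -tensm_comp.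
by rewrite triangle comp1m.
Qed.

(** Mirror argument: tensor with the unit on the right and use the pentagon at [X], [Y], [tunit],
    [tunit]. *)
Lemma runit_tens X Y : (idm X ⊗ runit Y) ∘ assoc X Y tunit = runit (X ⊗ Y).
Proof.
apply: tensm_unitr_inj.
apply: (inverse_monic (assocK _ _ _)).
rewrite tensm_compl (comp_tail _ (assoc_nat _ _ _)) -triangle tensm_compr.
rewrite -!compA (compA (idm X ⊗ assoc _ _ _)) -pentagon.
rewrite (comp_tail _ (esym (assoc_nat _ _ _))) tensm_id -compA.
by rewrite triangle.
Qed.

Lemma lunit_associ X Y :
  (lunit X ⊗ idm Y) ∘ associ tunit X Y = lunit (X ⊗ Y).
Proof. by rewrite -lunit_tens -compA (proj2 (assocK _ _ _)) compm1. Qed.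

Lemma runit_associ X Y :
  runit (X ⊗ Y) ∘ associ X Y tunit = idm X ⊗ runit Y.
Proof. by rewrite -runit_tens -compA (proj2 (assocK _ _ _)) compm1. Qed.

Lemma triangle_associ X Y :
  (runit X ⊗ idm Y) ∘ associ X tunit Y = idm X ⊗ lunit Y.
Proof. by rewrite -triangle -compA (proj2 (assocK _ _ _)) compm1. Qed.

Lemma triangle_inv X Y :
  associ X tunit Y ∘ (idm X ⊗ luniti Y) = runiti X ⊗ idm Y.
Proof.
apply: (inverse_monic (tensm_inverse (runitK X) (idm_inverse Y))).
rewrite compA triangle_associ -!tensm_comp.
by rewrite (proj2 (runitK _)) (proj2 (lunitK _)) !comp1m.
Qed.

Lemma luniti_tens X Y :
  assoc tunit X Y ∘ (luniti X ⊗ idm Y) = luniti (X ⊗ Y).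
Proof.
apply: (inverse_monic (lunitK _)); rewrite compA lunit_tens -tensm_comp.
by rewrite !(proj2 (lunitK _)) comp1m tensm_id.
Qed.

Lemma runiti_tens X Y :
  associ X Y tunit ∘ (idm X ⊗ runiti Y) = runiti (X ⊗ Y).
Proof.
apply: (inverse_monic (runitK _)); rewrite compA runit_associ -tensm_comp.
by rewrite !(proj2 (runitK _)) comp1m tensm_id.
Qed.

(** Naturality of [lunit] at [lunit tunit] itself gives [lunit (tunit ⊗ tunit) = idm tunit ⊗ lunit
    tunit]; the triangle turns this into the claim tensored with the unit. *)
Lemma lunit_unit : lunit tunit = runit tunit :> (tunit ⊗ tunit ~> (tunit : C)).
Proof.
apply: tensm_unitr_inj; rewrite -triangle -lunit_tens; congr (_ ∘ _).
by apply: (inverse_monic (lunitK _)); rewrite lunit_nat.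
Qed.

Lemma luniti_unit :
  luniti tunit = runiti tunit :> ((tunit : C) ~> tunit ⊗ tunit).
Proof.
apply: (inverse_monic (lunitK _)).
by rewrite (proj2 (lunitK _)) lunit_unit (proj2 (runitK _)).
Qed.

(** * Calculus of maps acting on the two middle factors *)

Lemma mid_comp X Y Z Y' Z' Y'' Z'' W (f : Y ⊗ Z ~> Y' ⊗ Z')
    (g : Y' ⊗ Z' ~> Y'' ⊗ Z'') :
  mid X W (g ∘ f) = mid X W g ∘ mid X W f.
Proof.
rewrite /mid -!compA (comp_cancel _ (proj2 (assocK _ _ _))).
rewrite (compA (idm X ⊗ _) (idm X ⊗ _)) -tensm_compr -!compA.
by rewrite (comp_cancel _ (proj1 (assocK _ _ _))) tensm_compl -!compA.
Qed.

Lemma mid_tens X Y Z Y' Z' W (y : Y ~> Y') (z : Z ~> Z') :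
  mid X W (y ⊗ z) = (idm X ⊗ y) ⊗ (z ⊗ idm W).
Proof.
rewrite /mid assoc_nat -(compA (y ⊗ _)) (proj2 (assocK _ _ _)) compm1.
by rewrite associ_nat -compA (proj1 (assocK _ _ _)) compm1.
Qed.

Lemma mid_outer X X' Y Z Y' Z' W W' (f : Y ⊗ Z ~> Y' ⊗ Z')
    (x : X ~> X') (w : W ~> W') :
  ((x ⊗ idm Y') ⊗ (idm Z' ⊗ w)) ∘ mid X W f
  = mid X' W' f ∘ ((x ⊗ idm Y) ⊗ (idm Z ⊗ w)).
Proof.
have inner : (idm Y' ⊗ (idm Z' ⊗ w)) ∘ (assoc Y' Z' W ∘ (f ⊗ idm W) ∘ associ Y Z W)
    = assoc Y' Z' W' ∘ (f ⊗ idm W') ∘ associ Y Z W' ∘ (idm Y ⊗ (idm Z ⊗ w)).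
  rewrite -!compA associ_nat (comp_tail _ (esym (assoc_nat _ _ _))) -!compA.
  congr (_ ∘ _); rewrite !compA; congr (_ ∘ _).
  by rewrite !tensm_id tensm_lr tensm_rl.
rewrite /mid -!compA assoc_nat (comp_tail _ (esym (associ_nat _ _ _))) -compA.
congr (_ ∘ _); rewrite !compA; congr (_ ∘ _).
by rewrite -!tensm_comp !comp1m !compm1 inner.
Qed.

Lemma mid_pre X0 X Y0 Y Z0 Z Y' Z' W0 W (f : Y ⊗ Z ~> Y' ⊗ Z')
    (x : X0 ~> X) (y : Y0 ~> Y) (z : Z0 ~> Z) (w : W0 ~> W) :
  mid X W f ∘ ((x ⊗ y) ⊗ (z ⊗ w))
  = ((x ⊗ idm Y') ⊗ (idm Z' ⊗ w)) ∘ mid X0 W0 (f ∘ (y ⊗ z)).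
Proof.
rewrite mid_comp mid_tens compA mid_outer -compA -!tensm_comp.
by rewrite !comp1m !compm1.
Qed.

Lemma mid_nat X X' Y Z Y' Z' Y0 Z0 Y0' Z0' W W' (f : Y ⊗ Z ~> Y' ⊗ Z')
    (g : Y0 ⊗ Z0 ~> Y0' ⊗ Z0') (x : X ~> X') (y : Y ~> Y0) (z : Z ~> Z0)
    (y' : Y' ~> Y0') (z' : Z' ~> Z0') (w : W ~> W') :
  g ∘ (y ⊗ z) = (y' ⊗ z') ∘ f ->
  mid X' W' g ∘ ((x ⊗ y) ⊗ (z ⊗ w)) = ((x ⊗ y') ⊗ (z' ⊗ w)) ∘ mid X W f.
Proof.
move=> e; rewrite mid_pre e mid_comp mid_tens compA -!tensm_comp.
by rewrite !comp1m !compm1.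
Qed.

(** Outer unit factors disappear up to invertible constraints, so [f] can be recovered from
    [mid tunit tunit f]. This reads relations on the exchange maps off the unit axioms of a cross
    product. *)
Lemma mid_units Y Z Y' Z' (f : Y ⊗ Z ~> Y' ⊗ Z') :
  (lunit Y' ⊗ runit Z') ∘ mid tunit tunit f = f ∘ (lunit Y ⊗ runit Z).
Proof.
rewrite /mid -tensm_rl -!compA (comp_tail _ (lunit_associ _ _)).
rewrite (comp_tail _ (lunit_nat _)) -!compA lunit_tens.
rewrite (comp_tail _ (runit_tens _ _)) (comp_tail _ (runit_nat _)) -compA.
by rewrite (comp_tail _ (runit_associ _ _)) tensm_rl.
Qed.

(** The middle map moves a unit object from the left of [Z] to its right. It is what remains of the
    exchange map [f] once [f] has met the unit of the second factor. *)
Lemma mid_unit_right X Z :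
  mid X tunit (runiti Z ∘ lunit Z)
  = (idm (X ⊗ Z) ⊗ luniti tunit) ∘ associ X Z tunit
    ∘ (runit X ⊗ idm (Z ⊗ tunit)).
Proof.
have e1 : assoc Z tunit tunit ∘ (runiti Z ⊗ idm tunit) = idm Z ⊗ luniti tunit.
  apply: (inverse_monic (tensm_inverse (idm_inverse Z) (lunitK tunit))).
  rewrite compA triangle -!tensm_comp.
  by rewrite (proj2 (runitK _)) (proj2 (lunitK _)) !comp1m.
rewrite /mid tensm_compl -!compA lunit_associ (comp_tail _ e1) tensm_compr -!compA.
by rewrite triangle (comp_tail _ (associ_nat _ _ _)) -compA tensm_id.
Qed.

Lemma mid_unit_left X W :
  mid tunit W (luniti X ∘ runit X)
  = (runiti tunit ⊗ idm (X ⊗ W)) ∘ assoc tunit X W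
    ∘ (idm (tunit ⊗ X) ⊗ lunit W).
Proof.
rewrite /mid tensm_compl -!compA triangle_associ.
rewrite (comp_tail _ (luniti_tens _ _)) tensm_compr -!compA.
by rewrite (comp_tail _ (triangle_inv _ _)) -assoc_nat tensm_id.
Qed.

End Coherence.

(** * The opposite monoidal category and duality between algebras and coalgebras *)

Section Opposite.
Variable C : monoidal_category.

(** Objects are kept and homs reversed definitionally, so a morphism of the opposite category is by
    conversion a morphism of [C], and dual statements are obtained without transport. *)
Definition op_category : category :=
  @Category C (fun X Y => Y ~> X) (@idm C) (fun X Y Z g f => f ∘ g)
    (fun X Y Z W h g f => esym (compA f g h))
    (fun X Y f => compm1 f) (fun X Y f => comp1m f).

Lemma op_inverse (X Y : C) (f : X ~> Y) (g : Y ~> X) :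
  inverse_morphisms f g -> @inverse_morphisms op_category X Y g f.
Proof. by case. Qed.

(** Cancelling the invertible associators of the right-hand side one at a time leaves the original
    pentagon. *)
Lemma op_pentagon (X Y Z W : C) :
  associ (X ⊗ Y) Z W ∘ associ X Y (Z ⊗ W)
  = (associ X Y Z ⊗ idm W) ∘ (associ X (Y ⊗ Z) W ∘ (idm X ⊗ associ Y Z W)).
Proof.
apply: (inverse_monic (tensm_inverse (assocK X Y Z) (idm_inverse W))).
apply: (inverse_monic (assocK X (Y ⊗ Z) W)).
apply: (inverse_monic (tensm_inverse (idm_inverse X) (assocK Y Z W))).
have [_ e] := tensm_inverse (assocK X Y Z) (idm_inverse W).
have [_ e'] := tensm_inverse (idm_inverse X) (assocK Y Z W).
rewrite (comp_cancel _ e) (comp_cancel _ (proj2 (assocK _ _ _))) e'.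
rewrite !compA -pentagon -!compA.
by rewrite (comp_cancel _ (proj2 (assocK _ _ _))) (proj2 (assocK _ _ _)).
Qed.

Definition op_monoidal : monoidal_category :=
  @MonoidalCategory op_category (@tens C) (fun X Y X' Y' f g => f ⊗ g)
    (@tunit C) (@tensm_id C)
    (fun X Y X' Y' X'' Y'' f f' g g' => tensm_comp f' f g' g)
    (@associ C) (@assoc C) (fun X Y Z => op_inverse (assocK X Y Z))
    (fun X Y Z X' Y' Z' f g h => esym (associ_nat f g h))
    (@luniti C) (@lunit C) (fun X => op_inverse (lunitK X))
    (fun X Y f => luniti_nat f)
    (@runiti C) (@runit C) (fun X => op_inverse (runitK X))
    (fun X Y f => runiti_nat f) op_pentagon (@triangle_inv C).

Lemma op_mulA (A : C) (c : coalgebra A) :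
  (comul c ⊗ idm A) ∘ comul c
  = associ A A A ∘ ((idm A ⊗ comul c) ∘ comul c).
Proof.
by rewrite -comulA -compA (comp_cancel _ (proj1 (assocK _ _ _))).
Qed.

Definition op_algebra (A : C) (c : coalgebra A) : @algebra op_monoidal A :=
  @Algebra op_monoidal A (comul c) (counit c) (op_mulA c)
    (comul1m c) (comulm1 c).

Lemma op_comulA (A : C) (a : @algebra op_monoidal A) :
  assoc A A A ∘ ((mul a : A ~> A ⊗ A) ⊗ idm A) ∘ (mul a : A ~> A ⊗ A)
  = (idm A ⊗ (mul a : A ~> A ⊗ A)) ∘ (mul a : A ~> A ⊗ A).
Proof.
rewrite -compA [X in _ ∘ X](mulA a).
by rewrite /= (comp_cancel _ (proj2 (assocK _ _ _))).
Qed.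

Definition op_coalgebra (A : C) (a : @algebra op_monoidal A) : coalgebra A :=
  @Coalgebra C A (mul a) (unit a) (op_comulA a) (mul1m a) (mulm1 a).

(** The construction is self-dual: reversal swaps [assoc] with [associ], and only the bracketing of
    the composites changes. *)
Lemma op_mid (X Y Z Y' Z' W : C) (f : Y ⊗ Z ~> Y' ⊗ Z') :
  @mid op_monoidal X Y' Z' Y Z W f = mid X W f.
Proof. by rewrite /mid /= !compA. Qed.

End Opposite.

(** * Algebras, retracts and fourfold products *)

Section Algebras.
Variable C : monoidal_category.

Lemma algebra_morphism_comp (A B D : C) (a : algebra A) (b : algebra B)
    (d : algebra D) (f : A ~> B) (g : B ~> D) :
  algebra_morphism a b f -> algebra_morphism b d g ->
  algebra_morphism a d (g ∘ f).
Proof.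
case=> fm fu [gm gu]; split; last by rewrite -compA fu.
by rewrite -compA fm compA gm -compA -tensm_comp.
Qed.

Lemma unit_square (A : C) (a : algebra A) :
  mul a ∘ (unit a ⊗ unit a) = unit a ∘ lunit tunit.
Proof. by rewrite -tensm_lr compA mul1m lunit_nat. Qed.

Section Retract.
Variables (A B : C) (a : algebra A) (i : B ~> A) (p : A ~> B)
  (m : B ⊗ B ~> B) (u : tunit ~> B).
Hypotheses (pi : p ∘ i = idm B)
  (im : i ∘ m = mul a ∘ (i ⊗ i)) (iu : i ∘ u = unit a).

Lemma section_monic (X : C) (f g : X ~> B) : i ∘ f = i ∘ g -> f = g.
Proof. by move=> e; rewrite -[f](comp_cancel _ pi) e (comp_cancel _ pi). Qed.

(** As [i] is a split monomorphism that intertwines [m] and [u] with the structure of [a], each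
    algebra axiom may be tested after composing with [i], where it comes from the axiom in [A]. *)
Lemma retract_mulA : m ∘ (m ⊗ idm B) = m ∘ (idm B ⊗ m) ∘ assoc B B B.
Proof.
apply: section_monic; rewrite !compA im -!compA.
rewrite (comp_tail _ (esym (tensm_comp _ _ _ _))) -!tensm_comp.
rewrite im compm1 -{3}[i]comp1m tensm_comp (comp_tail _ (mulA a)).
rewrite -!compA assoc_nat (comp_tail _ (esym (tensm_comp _ _ _ _))).
by rewrite comp1m.
Qed.

Lemma retract_mul1m : m ∘ (u ⊗ idm B) = lunit B.
Proof.
apply: section_monic; rewrite compA im -compA -tensm_comp.
by rewrite iu compm1 -tensm_lr compA mul1m lunit_nat.
Qed.

Lemma retract_mulm1 : m ∘ (idm B ⊗ u) = runit B.
Proof.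
apply: section_monic; rewrite compA im -compA -tensm_comp.
by rewrite iu compm1 -tensm_rl compA mulm1 runit_nat.
Qed.

Definition retract_algebra : algebra B :=
  Algebra retract_mulA retract_mul1m retract_mulm1.

End Retract.

(* Both sides of [mul_mid] are the fourfold product of [x], [y], [z], [w]
   bracketed with the middle pair multiplied first, so [f] only matters
   through [mul a ∘ (y ⊗ z) ∘ f]. *)
Lemma mul_mid (A : C) (a : algebra A) (X Y Z Y' Z' W : C)
    (f : Y ⊗ Z ~> Y' ⊗ Z') (x : X ~> A) (y : Y' ~> A) (z : Z' ~> A)
    (w : W ~> A) :
  mul a ∘ (mul a ⊗ mul a) ∘ ((x ⊗ y) ⊗ (z ⊗ w)) ∘ mid X W f
  = mul a ∘ (x ⊗ (mul a ∘ ((mul a ∘ (y ⊗ z) ∘ f) ⊗ w) ∘ associ Y Z W))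
    ∘ assoc X Y (Z ⊗ W).
Proof.
have mul4 : mul a ∘ (mul a ⊗ mul a) ∘ associ A A (A ⊗ A)
    = mul a ∘ (idm A ⊗ (mul a ∘ (idm A ⊗ mul a))).
  rewrite tensm_compr compA -tensm_lr compA mulA -!compA.
  rewrite -tensm_id (comp_tail _ (assoc_nat _ _ _)) -compA.
  by rewrite (proj2 (assocK _ _ _)) compm1.
have mul3 : mul a ∘ (idm A ⊗ mul a) ∘ assoc A A A = mul a ∘ (mul a ⊗ idm A).
  by rewrite mulA.
rewrite /mid -!compA (comp_tail _ (esym (associ_nat _ _ _))) -!compA.
rewrite 2!compA (compA _ _ (associ _ _ _)) mul4 -!compA.
congr (_ ∘ _); rewrite !compA; congr (_ ∘ _).
rewrite -!tensm_comp comp1m compm1; congr (_ ⊗ _).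
rewrite -!compA (comp_tail _ (esym (assoc_nat _ _ _))) !compA mul3 -!compA.
congr (_ ∘ _); rewrite !compA; congr (_ ∘ _).
by rewrite -!tensm_comp !comp1m compm1.
Qed.

End Algebras.

(** * Cross product multiplication and its canonical injections *)

Section CrossProduct.
Variable C : monoidal_category.

(** Both sides are instances of [mul_mid], one with middle map [f] on [i1], [i1], [i2], [i2], the
    other with the identity on [i1], [i2], [i1], [i2]. They agree because the hypothesis on [f]
    equates the two middle products. *)
Lemma mul_cross (A B1 B2 : C) (a : algebra A) (b1 : algebra B1)
    (b2 : algebra B2) (i1 : B1 ~> A) (i2 : B2 ~> A)
    (f : B2 ⊗ B1 ~> B1 ⊗ B2) :
  algebra_morphism b1 a i1 -> algebra_morphism b2 a i2 ->
  mul a ∘ (i1 ⊗ i2) ∘ f = mul a ∘ (i2 ⊗ i1) ->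
  mul a ∘ (i1 ⊗ i2) ∘ ((mul b1 ⊗ mul b2) ∘ mid B1 B2 f)
  = mul a ∘ ((mul a ∘ (i1 ⊗ i2)) ⊗ (mul a ∘ (i1 ⊗ i2))).
Proof.
case=> m1 _ [m2 _] ef.
rewrite -!compA (comp_tail _ (esym (tensm_comp _ _ _ _))) m1 m2 !tensm_comp.
have midid : mid B1 B2 (idm (B2 ⊗ B1)) = idm _.
  by rewrite -tensm_id mid_tens !tensm_id.
have := mul_mid a (idm (B2 ⊗ B1)) i1 i2 i1 i2.
rewrite midid !compm1 -!compA => ->.
rewrite (compA (_ ⊗ _) _ (mid _ _ _)) 2!(compA (mul a) _ _).
by rewrite (mul_mid a f) ef !compA.
Qed.

Section Injections.
Variables (B1 B2 : C) (b1 : algebra B1) (b2 : algebra B2)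
  (f : B2 ⊗ B1 ~> B1 ⊗ B2) (b : algebra (B1 ⊗ B2)).
Hypotheses (bmul : mul b = (mul b1 ⊗ mul b2) ∘ mid B1 B2 f)
  (bunit : unit b = (unit b1 ⊗ unit b2) ∘ luniti tunit).

(** In the strict notation this is id ⊗ η2, with [runiti] creating the unit factor. Read in the
    opposite category it becomes the projection id ⊗ ε2. *)
Definition cross_inl : B1 ~> B1 ⊗ B2 := (idm B1 ⊗ unit b2) ∘ runiti B1.
Definition cross_inr : B2 ~> B1 ⊗ B2 := (unit b1 ⊗ idm B2) ∘ luniti B2.

(** The left unit axiom of [b] is restricted to [B1] along id ⊗ η2. The outer multiplications absorb
    the outer units, and [mid_units] isolates [f] on [unit b2]. *)
Lemma cross_unit_left :
  f ∘ (unit b2 ⊗ idm B1) = (idm B1 ⊗ unit b2) ∘ (runiti B1 ∘ lunit B1).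
Proof.
apply: (inverse_epic (tensm_inverse (lunitK tunit) (runitK B1))).
have : mul b ∘ (unit b ⊗ idm (B1 ⊗ B2)) ∘ (lunit tunit ⊗ (idm B1 ⊗ unit b2))
    = lunit (B1 ⊗ B2) ∘ (lunit tunit ⊗ (idm B1 ⊗ unit b2)) by rewrite mul1m.
rewrite -(compA (mul b)) -tensm_comp bunit -(compA (_ ⊗ _)).
rewrite (proj1 (lunitK _)) comp1m compm1 bmul -(compA _ (mid _ _ _)) mid_pre.
rewrite compA -tensm_comp mul1m mulm1 mid_units => ->.
rewrite -(tensm_rl _ (idm B1 ⊗ unit b2)) -(tensm_rl _ (runit B1)) -!compA.
rewrite (comp_tail _ (lunit_nat _)) (comp_tail _ (lunit_nat _)) -!compA.
by rewrite (comp_cancel _ (proj1 (runitK _))).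
Qed.

Lemma cross_unit_right :
  f ∘ (idm B2 ⊗ unit b1) = (unit b1 ⊗ idm B2) ∘ (luniti B2 ∘ runit B2).
Proof.
apply: (inverse_epic (tensm_inverse (lunitK B2) (runitK tunit))).
have : mul b ∘ (idm (B1 ⊗ B2) ⊗ unit b) ∘ ((unit b1 ⊗ idm B2) ⊗ runit tunit)
    = runit (B1 ⊗ B2) ∘ ((unit b1 ⊗ idm B2) ⊗ runit tunit) by rewrite mulm1.
rewrite -(compA (mul b)) -tensm_comp bunit -(compA (_ ⊗ _)) luniti_unit.
rewrite (proj1 (runitK _)) comp1m compm1 bmul -(compA _ (mid _ _ _)) mid_pre.
rewrite compA -tensm_comp mul1m mulm1 mid_units => ->.
rewrite -(tensm_lr (unit b1 ⊗ idm B2)) -(tensm_lr (lunit B2)) -!compA.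
rewrite (comp_tail _ (runit_nat _)) (comp_tail _ (runit_nat _)) -!compA.
by rewrite (comp_cancel _ (proj1 (lunitK _))).
Qed.

(** The product of two copies of [cross_inl] meets [f] only on [unit b2], where [cross_unit_left]
    reduces it to a unit constraint; [unit_square] then merges the two copies of [unit b2]. *)
Lemma cross_inl_morphism : algebra_morphism b1 b cross_inl.
Proof.
split; last first.
  by rewrite bunit /cross_inl luniti_unit -compA -runiti_nat compA tensm_rl.
rewrite bmul /cross_inl tensm_comp -(compA _ (mid _ _ _)) (compA (mid _ _ _)).
rewrite mid_pre cross_unit_left mid_comp mid_tens mid_unit_right.
rewrite -!compA -tensm_comp (proj2 (runitK _)) comp1m runiti_tens.
rewrite !compA -!tensm_comp !tensm_id ?comp1m !compm1 -?compA.
rewrite (comp_tail _ (tensm_rl _ _)) (compA (mul b2)) unit_square -compA.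
by rewrite (proj2 (lunitK _)) compm1 -runiti_nat compA tensm_rl.
Qed.

Lemma cross_inr_morphism : algebra_morphism b2 b cross_inr.
Proof.
split; last first.
  by rewrite bunit /cross_inr -compA -luniti_nat compA tensm_lr.
rewrite bmul /cross_inr tensm_comp -(compA _ (mid _ _ _)) (compA (mid _ _ _)).
rewrite mid_pre cross_unit_right mid_comp mid_tens mid_unit_left.
rewrite -!compA -tensm_comp (proj2 (lunitK _)) comp1m luniti_tens.
rewrite !compA -!tensm_comp !tensm_id ?comp1m !compm1 -?compA.
rewrite (comp_tail _ (tensm_lr _ _)) (compA (mul b1)) unit_square lunit_unit -compA.
by rewrite (proj2 (runitK _)) compm1 -luniti_nat compA tensm_lr.
Qed.

(** Only the value of [f] on the two units enters, and [f] merely exchanges them; what is left are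
    unit axioms in each factor. *)
Lemma cross_mul_inl_inr : mul b ∘ (cross_inl ⊗ cross_inr) = idm (B1 ⊗ B2).
Proof.
have unit12 : f ∘ (unit b2 ⊗ unit b1) = unit b1 ⊗ unit b2.
  rewrite -tensm_lr compA cross_unit_left -!compA lunit_nat.
  rewrite (comp_tail _ (esym (runiti_nat _))) -!compA -luniti_unit.
  by rewrite (proj1 (lunitK _)) compm1 tensm_rl.
rewrite bmul /cross_inl /cross_inr tensm_comp.
rewrite -(compA _ (mid _ _ _)) (compA (mid _ _ _)) mid_pre unit12 mid_tens.
rewrite !tensm_id comp1m compA -!tensm_comp mulm1 mul1m.
by rewrite (proj2 (runitK _)) (proj2 (lunitK _)) tensm_id.
Qed.

End Injections.
End CrossProduct.

(** * Factorizations of a bialgebra *)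

Section Bialgebras.
Variables (C : braided_category) (A : C) (a : bialgebra A).

(** Condition (3), through which the implications between (1) and (2) pass. *)
Definition split_factorization : Prop :=
  exists (B1 B2 : C)
    (alg1 : algebra B1) (coalg1 : coalgebra B1)
    (alg2 : algebra B2) (coalg2 : coalgebra B2)
    (i1 : B1 ~> A) (i2 : B2 ~> A) (p1 : A ~> B1) (p2 : A ~> B2),
    algebra_morphism alg1 a i1 /\ algebra_morphism alg2 a i2 /\
    coalgebra_morphism a coalg1 p1 /\ coalgebra_morphism a coalg2 p2 /\
    p1 ∘ i1 = idm B1 /\ p2 ∘ i2 = idm B2 /\
    inverse_morphisms (mul a ∘ (i1 ⊗ i2)) ((p1 ⊗ p2) ∘ comul a).

Definition idempotent_factorization : Prop :=
  exists P1 P2 : A ~> A,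
    admissible_idempotent a P1 /\ admissible_idempotent a P2 /\
    splitting (P1 ⊗ P2) (mul a ∘ (P1 ⊗ P2)) ((P1 ⊗ P2) ∘ comul a).

(** Although [p] need not be multiplicative, it preserves the unit, since the unit of [A] comes from
    [B] through [i]. *)
Lemma retract_unit (B : C) (alg : algebra B) (i : B ~> A) (p : A ~> B) :
  algebra_morphism alg a i -> p ∘ i = idm B -> p ∘ unit a = unit alg.
Proof. by case=> _ <- pi; rewrite (comp_cancel _ pi). Qed.

Lemma retract_counit (B : C) (coalg : coalgebra B) (i : B ~> A) (p : A ~> B) :
  coalgebra_morphism a coalg p -> p ∘ i = idm B -> counit a ∘ i = counit coalg.
Proof. by case=> _ <- pi; rewrite -compA pi compm1. Qed.

(** Products of two factors in the image of [i] stay in that image, because [i] is multiplicative,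
    and [i ∘ p] fixes the image. The conditions on [comul a] are dual, with [p] in place of [i]. *)
Lemma retract_admissible (B : C) (alg : algebra B) (coalg : coalgebra B)
    (i : B ~> A) (p : A ~> B) :
  algebra_morphism alg a i -> coalgebra_morphism a coalg p ->
  p ∘ i = idm B -> admissible_idempotent a (i ∘ p).
Proof.
move=> ialg pcoalg pi.
have pu := retract_unit ialg pi; have ie := retract_counit pcoalg pi.
have [im iu] := ialg; have [pm pe] := pcoalg.
split; first by rewrite /idempotent_morphism -compA (comp_cancel _ pi).
split.
  have e : mul a ∘ ((i ∘ p) ⊗ (i ∘ p)) = i ∘ (mul alg ∘ (p ⊗ p)).
    by rewrite tensm_comp compA -im -compA.
  by rewrite -(compA (i ∘ p)) e -(compA i p) (comp_cancel _ pi).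
split; first by rewrite -compA pu iu.
split; last by rewrite compA ie pe.
rewrite tensm_comp -!compA (compA (p ⊗ p)) -pm -!compA.
by rewrite (comp_cancel _ pi).
Qed.

Lemma idempotents_of_split :
  split_factorization -> idempotent_factorization.
Proof.
case=> B1 [B2 [alg1 [coalg1 [alg2 [coalg2 [i1 [i2 [p1 [p2 H]]]]]]]]].
have [ia1 [ia2 [pc1 [pc2 [pi1 [pi2 [gf fg]]]]]]] := H.
have adm1 := retract_admissible ia1 pc1 pi1.
have adm2 := retract_admissible ia2 pc2 pi2.
exists (i1 ∘ p1), (i2 ∘ p2); split=> //; split=> //.
have pi : (p1 ⊗ p2) ∘ (i1 ⊗ i2) = idm _ by rewrite -tensm_comp pi1 pi2 tensm_id.
(* With F and G the two mutually inverse maps, the sequence is F ∘ (p1 ⊗ p2) followed by (i1 ⊗ i2) ∘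
   G; each composite collapses by one of the two inverse laws. *)
rewrite /splitting tensm_comp; split.
  rewrite -!compA (comp_cancel _ pi).
  by move: fg; rewrite -!compA.
rewrite -!compA; congr (_ ∘ _).
by move: gf; rewrite !compA => ->; rewrite comp1m.
Qed.

Lemma retract_of_admissible (B : C) (P : A ~> A) (p : A ~> B) (i : B ~> A) :
  admissible_idempotent a P -> splitting P p i ->
  (exists alg : algebra B, algebra_morphism alg a i) /\
  (exists coalg : coalgebra B, coalgebra_morphism a coalg p).
Proof.
case=> _ [Pm [Pu [Pc Pe]]] [pi ip].
have Pi : P ∘ i = i by rewrite -ip -compA pi compm1.
have pP : p ∘ P = p by rewrite -ip (comp_cancel _ pi).
split.
  have im : i ∘ (p ∘ mul a ∘ (i ⊗ i)) = mul a ∘ (i ⊗ i).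
    by rewrite !compA ip -{1 2}Pi tensm_comp !compA -Pm -compA -tensm_comp Pi.
  have iu : i ∘ (p ∘ unit a) = unit a by rewrite compA ip Pu.
  by exists (retract_algebra pi im iu); split.
have pm : (p ⊗ p) ∘ comul a ∘ i ∘ p = (p ⊗ p) ∘ comul a.
  rewrite -(compA _ i) ip -{1 2}pP tensm_comp -!compA (compA (P ⊗ P)) -Pc.
  by rewrite compA -tensm_comp pP.
have pe : counit a ∘ i ∘ p = counit a by rewrite -compA ip Pe.
(* Dually, [p] is the section and [i] the retraction in the opposite category. *)
exists (op_coalgebra (@retract_algebra (op_monoidal C) A B (op_algebra a) p i
  ((p ⊗ p) ∘ comul a ∘ i) (counit a ∘ i) pi pm pe)).
by split.
Qed.

Lemma split_of_idempotents :
  idempotents_split C -> idempotent_factorization -> split_factorization.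
Proof.
move=> Csplit [P1 [P2 [adm1 [adm2 [s1 s2]]]]].
have [B1 [p1 [i1 sp1]]] := Csplit _ _ (proj1 adm1).
have [B2 [p2 [i2 sp2]]] := Csplit _ _ (proj1 adm2).
have [[alg1 ia1] [coalg1 pc1]] := retract_of_admissible adm1 sp1.
have [[alg2 ia2] [coalg2 pc2]] := retract_of_admissible adm2 sp2.
case: sp1 sp2 => pi1 ip1 [pi2 ip2].
exists B1, B2, alg1, coalg1, alg2, coalg2, i1, i2, p1, p2.
do 6!split=> //.
have pi : (p1 ⊗ p2) ∘ (i1 ⊗ i2) = idm _ by rewrite -tensm_comp pi1 pi2 tensm_id.
have ip : (i1 ⊗ i2) ∘ (p1 ⊗ p2) = P1 ⊗ P2 by rewrite -tensm_comp ip1 ip2.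
split.
  (* Inserting the identity (p1 ⊗ p2) ∘ (i1 ⊗ i2) at both ends exposes the composite that [s2]
     equates with P1 ⊗ P2. *)
  transitivity ((p1 ⊗ p2) ∘ (((i1 ⊗ i2) ∘ (p1 ⊗ p2) ∘ comul a)
    ∘ (mul a ∘ ((i1 ⊗ i2) ∘ (p1 ⊗ p2)))) ∘ (i1 ⊗ i2)).
    by rewrite -!compA pi compm1 (comp_cancel _ pi).
  by rewrite ip s2 -ip -!compA pi compm1.
by rewrite -[RHS]s1 -ip -!compA (comp_cancel _ pi).
Qed.

(** Each of [f] and [g] preserves only half of the structure by hypothesis, but an inverse of an
    algebra or coalgebra isomorphism is again one. All compatibility axioms of [a] therefore carry
    over to the prescribed [alg] and [coalg]. *)
Lemma transport_bialgebra (B : C) (f : A ~> B) (g : B ~> A)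
    (alg : algebra B) (coalg : coalgebra B) :
  inverse_morphisms f g -> algebra_morphism alg a g ->
  coalgebra_morphism a coalg f ->
  exists b : bialgebra B, bialg_alg b = alg /\ bialg_coalg b = coalg
    /\ bialgebra_isomorphic a b.
Proof.
move=> fg galg fcoalg; have [gf fg1] := fg.
have gfI : inverse_morphisms g f by split.
have [gm gu] := galg; have [fc fe] := fcoalg.
have fm : f ∘ mul a = mul alg ∘ (f ⊗ f).
  apply: (inverse_epic (tensm_inverse gfI gfI)).
  rewrite -!compA -gm (comp_cancel _ fg1) -tensm_comp fg1 tensm_id.
  by rewrite compm1.
have fu : f ∘ unit a = unit alg by rewrite -gu (comp_cancel _ fg1).
have gc : comul a ∘ g = (g ⊗ g) ∘ comul coalg.
  apply: (inverse_epic fg); rewrite -!compA fc gf compm1.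
  by rewrite compA -tensm_comp gf tensm_id comp1m.
have ge : counit a ∘ g = counit coalg by rewrite -fe -compA fg1 compm1.
have comul_mul : comul coalg ∘ mul alg = (mul alg ⊗ mul alg)
    ∘ mid B B (braid B B) ∘ (comul coalg ⊗ comul coalg).
  apply: (inverse_epic (tensm_inverse fg fg)).
  rewrite -(compA (comul _)) -fm compA fc -(compA (f ⊗ f)) bialg_comul_mul.
  rewrite -(compA (_ ∘ _)) -tensm_comp fc tensm_comp.
  rewrite (compA (_ ∘ _)) -(compA _ (mid B B _)).
  (* Naturality of the braiding lets the four copies of [f] pass through the middle exchange. *)
  rewrite (mid_nat _ _ (braid_nat f f)) !(compA (mul alg ⊗ _)).
  by rewrite -tensm_comp -fm tensm_comp -!(compA (f ⊗ f)).
have counit_mul : counit coalg ∘ mul alg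
    = lunit tunit ∘ (counit coalg ⊗ counit coalg).
  rewrite -ge -compA gm compA bialg_counit_mul.
  by rewrite -compA -tensm_comp.
have unit_comul : comul coalg ∘ unit alg
    = (unit alg ⊗ unit alg) ∘ luniti tunit.
  rewrite -fu compA fc -compA bialg_unit_comul.
  by rewrite compA -tensm_comp.
have counit_unit : counit coalg ∘ unit alg = idm tunit.
  by rewrite -ge -fu -compA (comp_cancel _ gf) bialg_counit_unit.
exists (Bialgebra comul_mul counit_mul unit_comul counit_unit).
by do 2!split=> //; exists f, g.
Qed.

Lemma cross_product_of_split :
  split_factorization ->
  exists T : BAT C, bialgebra_isomorphic a (bat_bialg T).
Proof.
case=> B1 [B2 [alg1 [coalg1 [alg2 [coalg2 [i1 [i2 [p1 [p2 H]]]]]]]]].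
have [ia1 [ia2 [pc1 [pc2 [pi1 [pi2 FG]]]]]] := H.
have pu1 := retract_unit ia1 pi1; have pu2 := retract_unit ia2 pi2.
set F := mul a ∘ _ in FG; set G := _ ∘ comul a in FG.
have [GF FG1] := FG.
pose f21 := G ∘ (mul a ∘ (i2 ⊗ i1)).
pose f12 := (p2 ⊗ p1) ∘ comul a ∘ F.
have Fmul : F ∘ ((mul alg1 ⊗ mul alg2) ∘ mid B1 B2 f21) = mul a ∘ (F ⊗ F).
  by apply: (mul_cross ia1 ia2); rewrite (comp_cancel _ FG1).
have Fu : F ∘ ((unit alg1 ⊗ unit alg2) ∘ luniti tunit) = unit a.
  rewrite /F -compA (compA (i1 ⊗ i2)) -tensm_comp (proj2 ia1) (proj2 ia2).
  by rewrite compA unit_square -compA (proj2 (lunitK _)) compm1.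
have Gcomul : mid B1 B2 f12 ∘ (comul coalg1 ⊗ comul coalg2) ∘ G
    = (G ⊗ G) ∘ comul a.
  (* In the opposite category [p1] and [p2] are algebra morphisms, so this is [mul_cross] with [f12]
     as exchange map. *)
  rewrite -op_mid.
  apply: (@mul_cross (op_monoidal C) A B1 B2 (op_algebra a) (op_algebra coalg1)
    (op_algebra coalg2) p1 p2 f12 pc1 pc2).
  by rewrite /= /f12 -/G -compA FG1 compm1.
have Ge : lunit tunit ∘ (counit coalg1 ⊗ counit coalg2) ∘ G = counit a.
  rewrite /G -compA (compA (_ ⊗ _)) -tensm_comp (proj2 pc1) (proj2 pc2).
  rewrite [X in _ ∘ X](unit_square (op_algebra a)) /=.
  by rewrite (comp_cancel _ (proj2 (lunitK _))).
(* Associativity and unitality of the cross product operations come for free along the isomorphism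
   [F], and dually along [G]. *)
pose alg := retract_algebra GF Fmul Fu.
pose coalg := op_coalgebra (@retract_algebra (op_monoidal C) A (B1 ⊗ B2)%obj
  (op_algebra a) G F _ _ GF Gcomul Ge).
have FGI : inverse_morphisms G F by split.
have algF : algebra_morphism alg a F by split.
have coalgG : coalgebra_morphism a coalg G by split.
have [b [eb1 [eb2 iso]]] := transport_bialgebra FGI algF coalgG.
have e1 : counit coalg1 ∘ unit alg1 = idm tunit.
  by rewrite -pu1 compA (proj2 pc1) bialg_counit_unit.
have e2 : counit coalg2 ∘ unit alg2 = idm tunit.
  by rewrite -pu2 compA (proj2 pc2) bialg_counit_unit.
(* The structures transported to [B1 ⊗ B2] were built from the cross product formulas, so the four
   remaining equations hold by reflexivity. *)
unshelve eexists (@MkBAT C B1 B2 alg1 alg2 coalg1 coalg2 e1 e2 f12 f21 b _ _ _ _).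
all: rewrite ?eb1 ?eb2 //.
Qed.

(** The canonical injections and projections of the cross product are carried to [A] along the
    isomorphism; [p_j ∘ i_j] is the identity because the counit of each factor sends its unit to the
    identity. *)
Lemma split_of_cross_product :
  (exists T : BAT C, bialgebra_isomorphic a (bat_bialg T)) ->
  split_factorization.
Proof.
case=> T [f [g [[falg fcoalg] [[galg gcoalg] [gf fg]]]]].
have bcomul : @mul (op_monoidal C) _ (op_algebra (bat_bialg T))
    = @comp (op_monoidal C) _ _ _
        (@tensm (op_monoidal C) _ _ _ _ (mul (op_algebra (bat_coalg1 T)))
          (mul (op_algebra (bat_coalg2 T))))
        (@mid (op_monoidal C) (bat1 T) _ _ _ _ (bat2 T) (bat_phi12 T)).
  by rewrite op_mid; exact: bat_comul.
have bmul := bat_mul T; have bunit := bat_unit T.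
have bcounit := bat_counit T.
pose i1 := cross_inl (bat1 T) (bat_alg2 T).
pose i2 := cross_inr (bat2 T) (bat_alg1 T).
pose p1 : bat1 T ⊗ bat2 T ~> bat1 T :=
  @cross_inl (op_monoidal C) (bat1 T) (bat2 T) (op_algebra (bat_coalg2 T)).
pose p2 : bat1 T ⊗ bat2 T ~> bat2 T :=
  @cross_inr (op_monoidal C) (bat1 T) (bat2 T) (op_algebra (bat_coalg1 T)).
have ia1 : algebra_morphism _ _ i1 := cross_inl_morphism bmul bunit.
have ia2 : algebra_morphism _ _ i2 := cross_inr_morphism bmul bunit.
have pc1 : coalgebra_morphism (bat_bialg T) (bat_coalg1 T) p1 :=
  @cross_inl_morphism (op_monoidal C) _ _ _ _ _ _ bcomul bcounit.
have pc2 : coalgebra_morphism (bat_bialg T) (bat_coalg2 T) p2 :=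
  @cross_inr_morphism (op_monoidal C) _ _ _ _ _ _ bcomul bcounit.
have mi : mul (bat_bialg T) ∘ (i1 ⊗ i2) = idm _ :=
  cross_mul_inl_inr bmul bunit.
have pm : (p1 ⊗ p2) ∘ comul (bat_bialg T) = idm _ :=
  @cross_mul_inl_inr (op_monoidal C) _ _ _ _ _ _ bcomul bcounit.
have pi1 : p1 ∘ i1 = idm _.
  rewrite /p1 /i1 /cross_inl /= -compA (compA (idm _ ⊗ _)) -tensm_comp.
  rewrite bat_counit_unit2 comp1m tensm_id comp1m.
  exact: (proj2 (runitK _)).
have pi2 : p2 ∘ i2 = idm _.
  rewrite /p2 /i2 /cross_inr /= -compA (compA (_ ⊗ idm _)) -tensm_comp.
  rewrite bat_counit_unit1 comp1m tensm_id comp1m.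
  exact: (proj2 (lunitK _)).
exists (bat1 T), (bat2 T), (bat_alg1 T), (bat_coalg1 T), (bat_alg2 T).
exists (bat_coalg2 T), (g ∘ i1), (g ∘ i2), (p1 ∘ f), (p2 ∘ f).
split; first exact: algebra_morphism_comp ia1 galg.
split; first exact: algebra_morphism_comp ia2 galg.
split.
  exact: (@algebra_morphism_comp (op_monoidal C) _ _ _ (op_algebra _)
    (op_algebra _) (op_algebra _) p1 f pc1 fcoalg).
split.
  exact: (@algebra_morphism_comp (op_monoidal C) _ _ _ (op_algebra _)
    (op_algebra _) (op_algebra _) p2 f pc2 fcoalg).
split; first by rewrite -compA (compA f) fg comp1m.
split; first by rewrite -compA (compA f) fg comp1m.
(* The two maps to be shown inverse reduce to [g] and [f] themselves. *)
rewrite tensm_comp compA -(proj1 galg) -(compA g (mul _)) mi compm1.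
rewrite tensm_comp -(compA (p1 ⊗ p2)) -(proj1 fcoalg) compA pm comp1m.
by split.
Qed.

End Bialgebras.

Theorem proposition2p2 (C : braided_category) (Csplit : idempotents_split C)
    (A : C) (a : bialgebra A) :
  let statement1 :=
    exists T : BAT C, bialgebra_isomorphic a (bat_bialg T) in
  let statement2 :=
    exists P1 P2 : A ~> A,
      admissible_idempotent a P1 /\ admissible_idempotent a P2 /\
      splitting (P1 ⊗ P2) (mul a ∘ (P1 ⊗ P2)) ((P1 ⊗ P2) ∘ comul a) in
  let statement3 :=
    exists (B1 B2 : C)
      (alg1 : algebra B1) (coalg1 : coalgebra B1)
      (alg2 : algebra B2) (coalg2 : coalgebra B2)
      (i1 : B1 ~> A) (i2 : B2 ~> A) (p1 : A ~> B1) (p2 : A ~> B2),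
      algebra_morphism alg1 a i1 /\ algebra_morphism alg2 a i2 /\
      coalgebra_morphism a coalg1 p1 /\ coalgebra_morphism a coalg2 p2 /\
      p1 ∘ i1 = idm B1 /\ p2 ∘ i2 = idm B2 /\
      inverse_morphisms (mul a ∘ (i1 ⊗ i2)) ((p1 ⊗ p2) ∘ comul a) in
  (statement1 <-> statement2) /\ (statement2 <-> statement3).
Proof.
split; split.
- by move/split_of_cross_product/idempotents_of_split.
- by move/(split_of_idempotents Csplit)/cross_product_of_split.
- exact: split_of_idempotents.
- exact: idempotents_of_split.
Qed.
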